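(* Fix constants $0<\alpha<\alpha'<1$ and suppose $k=k(n)$ satisfies $c(Q_n)\le k\le e^{n^{\alpha}}$. Then for all sufficiently large $n$, $\mathrm{capt}_k(Q_n)\ge \frac{1-\alpha'}{2}(n-1)\log n$.
   Context: $Q_n$ is the $n$-dimensional hypercube on $2^n$ vertices, viewed as a reflexive graph; $c(Q_n)=\lceil (n+1)/2\rceil$ is its cop number. The game of Cops and Robbers: cops choose starting vertices (round 0), then the robber; players alternate, cops (any subset) moving to adjacent vertices or staying put, then the robber moving or staying; cops win by occupying the robber's vertex. For $k\ge c(G)$, $\mathrm{capt}_k(G)$ is the minimum over $k$-cop strategies of the number of rounds (excluding round 0) until capture against an optimally evading robber. $\log$ is the natural logarithm. *)

(* Defs.v *)
From HB Require Import structures.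
From mathcomp Require Import all_boot all_order all_algebra.
From mathcomp Require Import all_classical all_reals all_analysis.

Set Implicit Arguments.
Unset Strict Implicit.
Unset Printing Implicit Defensive.

Import Order.TTheory GRing.Theory Num.Theory.

Local Open Scope classical_set_scope.
Local Open Scope ring_scope.

Section CopsAndRobbers.
Context (V : finType) (e : rel V).

Definition game_move (x y : V) : bool := (x == y) || e x y.

(* A k-cop strategy maps the list of the robber's successive positions so far
   to the positions of the k cops; its value at [::] is the placement of the
   cops in round 0. There is no loss in omitting the cops' own past positions
   from the history, since the strategy determines them. *)
Definition cop_strategy (k : nat) := seq V -> 'I_k -> V.

Definition legal_cops (k : nat) (s : cop_strategy k) : Prop :=
  forall (h : seq V) (x : V) (i : 'I_k), game_move (s h i) (s (rcons h x) i).

Definition legal_robber (r : nat -> V) : Prop :=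
  forall t : nat, game_move (r t) (r t.+1).

(* In round t >= 1 the cops first move to s [:: r 0; ...; r (t - 1)] while the
   robber is at r (t - 1), and then the robber moves to r t; the robber may be
   caught by either move. In round 0 the robber is placed at r 0. *)
Definition captured_in_round (k : nat) (s : cop_strategy k) (r : nat -> V)
    (t : nat) : Prop :=
  exists i : 'I_k, s (mkseq r t) i = r t \/
                   ((0 < t)%N /\ s (mkseq r t) i = r t.-1).

Definition cops_win (k : nat) : Prop :=
  exists2 s : cop_strategy k, legal_cops s &
    forall r : nat -> V, legal_robber r -> exists t, captured_in_round s r t.

Lemma cops_win_card : exists k, `[< cops_win k >].
Proof.
exists #|V|; apply/asboolP; exists (fun _ => @enum_val V V).
  by move=> h x i; rewrite /game_move eqxx.
by move=> r _; exists 0%N, (enum_rank (r 0%N)); left; rewrite enum_rankK.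
Qed.

Definition cop_number : nat := ex_minn cops_win_card.

(* +oo if the robber is never captured *)
Definition rounds_to_capture (R : realType) (k : nat) (s : cop_strategy k)
    (r : nat -> V) : \bar R :=
  ereal_inf [set t%:R%:E | t in captured_in_round s r].

Definition capt (R : realType) (k : nat) : \bar R :=
  ereal_inf [set ereal_sup [set rounds_to_capture R s r | r in legal_robber]
            | s in @legal_cops k].

End CopsAndRobbers.

Definition hypercube (n : nat) : rel {ffun 'I_n -> bool} :=
  fun x y => #|[set i | x i != y i]%SET| == 1%N.

(* Main.v *)
(* The robber keeps the potential sum_i exp (- a_t (D_i - 1)) below 1, where D_i
   is his distance to the i-th cop after round t; then every D_i is at least 2
   and the next cop move cannot capture him. If a cop is at distance d after the
   cops' move, a uniformly random move of the robber changes d to d - 1 with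
   probability d / n and to d + 1 otherwise, so the mean of the new weight is at
   most exp (- a_t (D_i - 1)) as soon as exp (2 a_(t+1)) - 1 <= n (a_(t+1) - a_t);
   hence some neighbour keeps the potential below 1. For a small constant e and
   c slightly above 2, the weights a_t = e (1 - c / n)^(T - t) qualify, and with
   T <= (1 - alpha') / 2 * (n - 1) ln n one gets a_0 >= e n^(- beta) for some
   beta < 1 - alpha. Over a random starting vertex the mean of the initial
   potential is at most k exp (a_0 - n a_0 / 4), which is below 1 because
   n^(1 - beta) dominates n^alpha. *)

Require Import Defs.
From HB Require Import structures.
From mathcomp Require Import all_boot all_order all_algebra.
From mathcomp Require Import all_classical all_reals all_analysis.
From mathcomp Require Import ring lra.

Set Implicit Arguments.
Unset Strict Implicit.
Unset Printing Implicit Defensive.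

Import Order.TTheory GRing.Theory Num.Theory.

Local Open Scope classical_set_scope.
Local Open Scope ring_scope.

(** * From invariants to robber walks *)

Lemma robber_of_invariant (V : finType) (e : rel V) (P : seq V -> V -> Prop)
    (x0 : V) :
  P [::] x0 ->
  (forall h x, P h x -> exists2 y, game_move e x y & P (rcons h x) y) ->
  exists2 r : nat -> V, legal_robber e r & forall t, P (mkseq r t) (r t).
Proof.
move=> P0 step.
pose next h x := xget x [set y | game_move e x y /\ P (rcons h x) y].
(* [state t] pairs the history before round [t] with the position in round [t]. Since [P] holds
   along it, the default value of [xget] never occurs. *)
pose state := fix state t := if t is u.+1
  then (rcons (state u).1 (state u).2, next (state u).1 (state u).2)
  else ([::], x0).
have nextP h x : P h x -> game_move e x (next h x) /\ P (rcons h x) (next h x).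
  move=> /step[y xy Py]; rewrite /next.
  by case: xgetP => [z -> //|/(_ y)[]].
have stateP t : P (state t).1 (state t).2.
  by elim: t => //= t /nextP[].
exists (fun t => (state t).2) => [t|t]; first by have /nextP[] := stateP t.
suff -> : mkseq (fun t => (state t).2) t = (state t).1 by exact: stateP.
by elim: t => // t IH; rewrite mkseqS IH.
Qed.

(** * Hamming distance on the hypercube *)

Section Hamming.
Context (n : nat).
Implicit Types x y c : {ffun 'I_n -> bool}.

Definition hdist x y : nat := #|[set i | x i != y i]%SET|.

Definition flip (j : 'I_n) x : {ffun 'I_n -> bool} :=
  [ffun i => if i == j then ~~ x i else x i].

Lemma hypercube_flip j x : hypercube x (flip j x).
Proof.
rewrite /hypercube (_ : [set i | _]%SET = [set j]%SET) ?cards1 //.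
by apply/setP => i; rewrite !inE ffunE; case: (i == j); case: (x i).
Qed.

Lemma hdistxx x : hdist x x = 0%N.
Proof. by rewrite /hdist eq_card0 // => i; rewrite !inE eqxx. Qed.

Lemma hdist_move c c' x :
  game_move (@hypercube n) c c' -> (hdist c x <= (hdist c' x).+1)%N.
Proof.
case/orP => [/eqP -> //|/eqP cc'].
rewrite -add1n -cc'; apply: leq_trans (leq_card_setU _ _).
apply/subset_leq_card/fintype.subsetP => i; rewrite !inE.
by case: (c i); case: (c' i); case: (x i).
Qed.

Lemma hdist_flip c j x :
  (hdist c (flip j x) + (c j != x j).*2)%N = (hdist c x).+1.
Proof.
rewrite /hdist (cardsD1 j) [in RHS](cardsD1 j) !inE ffunE eqxx.
rewrite (_ : [set i | c i != flip j x i]%SET :\ j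
           = [set i | c i != x i]%SET :\ j)%SET.
  by case: (c j); case: (x j); rewrite /= ?add0n ?addn0 ?addn2 ?add1n.
by apply/setP => i; rewrite !inE ffunE; case: (i == j).
Qed.

(** Flipping one of the [hdist c x] coordinates where [c] and [x] differ lowers the distance by one;
    any other flip raises it. At distance 0 the truncated predecessor has multiplicity 0. *)
Lemma sum_flip_hdist (A : pzRingType) (f : nat -> A) c x :
  \sum_j f (hdist c (flip j x)) =
    f (hdist c x).-1 *+ hdist c x + f (hdist c x).+1 *+ (n - hdist c x).
Proof.
rewrite (bigID (fun j => c j != x j)) /=; congr (_ + _).
  rewrite (eq_bigr (fun=> f (hdist c x).-1)).
    by rewrite sumr_const /hdist cardsE.
  by move=> j cj; have := hdist_flip c j x; rewrite cj addn2 => -[<-].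
rewrite (eq_bigr (fun=> f (hdist c x).+1)).
  rewrite sumr_const; congr (_ *+ _).
  rewrite -[in RHS](card_ord n) -(cardC [set i | c i != x i]%SET) addKn.
  by apply: eq_card => i; rewrite !inE.
by move=> j cj; have := hdist_flip c j x; rewrite (negbTE cj) addn0 => ->.
Qed.

(** The sum factors over coordinates: each contributes 1 for agreement with [c] and [q] for
    disagreement. *)
Lemma sum_exp_hdist (A : comNzRingType) (q : A) c :
  \sum_x q ^+ hdist c x = (1 + q) ^+ n.
Proof.
have -> : (1 + q) ^+ n = \prod_(i < n) \sum_(b : bool) q ^+ (c i != b).
  rewrite -[in LHS](card_ord n) -prodr_const; apply: eq_bigr => i _.
  by rewrite big_bool; case: (c i); rewrite /= ?expr0 ?expr1 // addrC.
rewrite bigA_distr_bigA; apply: eq_bigr => x _.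
rewrite prodrXr; congr (_ ^+ _).
rewrite /hdist -sum1_card big_mkcond; apply: eq_bigr => i _.
by rewrite inE; case: eqP.
Qed.

End Hamming.

(** * The exponential potential and the robber's evasion *)

Section Potential.
Context (R : realType) (n : nat).
Implicit Types (x y c : {ffun 'I_n -> bool}) (a b : R).

Definition weight a c x : R := expR (- (a * ((hdist c x)%:R - 1))).

Lemma weight_ge0 a c x : 0 <= weight a c x.
Proof. exact: expR_ge0. Qed.

Lemma weight_lt1 a c x : 0 <= a -> weight a c x < 1 -> (1 < hdist c x)%N.
Proof.
move=> a0; rewrite /weight expR_lt1 oppr_lt0 ltnNge => h.
apply/negP => d1; move: h; rewrite ltNge mulr_ge0_le0 //.
by rewrite subr_le0 (ler_nat R _ 1).
Qed.

Lemma sum_weight a c :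
  \sum_x weight a c x = expR a * (1 + expR (- a)) ^+ n.
Proof.
rewrite -(sum_exp_hdist (expR (- a)) c) big_distrr; apply: eq_bigr => x _ /=.
by rewrite -expRM_natl -expRD /weight; congr expR; ring.
Qed.

(** With d the distance to [c'], the sum is exp(-bd) (n + d (exp(2b) - 1)), at most n exp(-ad) by
    the hypothesis and 1 + u <= exp u. The cop's move shortens the distance by at most one, which
    the -1 in [weight] absorbs. *)
Lemma sum_flip_weight a b c c' x :
  (0 < n)%N -> 0 <= a -> expR (2 * b) - 1 <= n%:R * (b - a) ->
  game_move (@hypercube n) c c' ->
  \sum_j weight b c' (flip j x) <= n%:R * weight a c x.
Proof.
move=> n_gt0 a0 hab cc'.
rewrite (sum_flip_hdist (fun m => expR (- (b * (m%:R - 1))))).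
have n0 : 0 < n%:R :> R by rewrite ltr0n.
set d := hdist c' x.
have dn : (d <= n)%N by rewrite -[leqRHS](card_ord n) max_card.
have -> : expR (- (b * (d.-1%:R - 1))) *+ d =
    d%:R * (expR (- (b * d%:R)) * expR (2 * b)).
  case: d dn => [|d] _; first by rewrite mulr0n mul0r.
  by rewrite -expRD -[LHS]mulr_natl; congr (_ * expR _); rewrite /= -natr1; ring.
have -> : expR (- (b * (d.+1%:R - 1))) *+ (n - d) =
    (n%:R - d%:R) * expR (- (b * d%:R)).
  by rewrite -[LHS]mulr_natl natrB //; congr (_ * expR _); rewrite -natr1; ring.
apply: (@le_trans _ _ (n%:R * (expR (- (b * d%:R)) * expR (d%:R * (b - a))))).
  have -> : d%:R * (expR (- (b * d%:R)) * expR (2 * b)) +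
     (n%:R - d%:R) * expR (- (b * d%:R)) =
     expR (- (b * d%:R)) * (n%:R + d%:R * (expR (2 * b) - 1)) :> R by ring.
  rewrite mulrCA ler_wpM2l ?expR_ge0 //.
  apply: (@le_trans _ _ (n%:R + d%:R * (n%:R * (b - a)))).
    by rewrite lerD2l ler_wpM2l.
  have -> : n%:R + d%:R * (n%:R * (b - a)) =
      n%:R * (1 + d%:R * (b - a)) :> R by ring.
  by rewrite ler_wpM2l ?expR_ge1Dx // ltW.
rewrite ler_wpM2l ?(ltW n0) // -expRD /weight ler_expR.
have -> : - (b * d%:R) + d%:R * (b - a) = - (a * d%:R) by ring.
rewrite lerN2 ler_wpM2l // lerBlDr natr1 ler_nat.
exact: hdist_move.
Qed.

Lemma exists_lt1 (I : finType) (F : I -> R) :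
  \sum_i F i < #|I|%:R -> exists i, F i < 1.
Proof.
move=> h; apply/not_existsP => F1; move: h; apply/negP.
rewrite -leNgt -sumr_const; apply: ler_sum => i _.
by rewrite leNgt; apply/negP/F1.
Qed.

Lemma evasion (k T : nat) (a : nat -> R) (s : cop_strategy {ffun 'I_n -> bool} k) :
  (0 < n)%N -> legal_cops (@hypercube n) s ->
  (forall t, 0 <= a t) ->
  (forall t, (t < T)%N -> expR (2 * a t.+1) - 1 <= n%:R * (a t.+1 - a t)) ->
  k%:R * (expR (a 0%N) * ((1 + expR (- a 0%N)) / 2) ^+ n) < 1 ->
  exists2 r, legal_robber (@hypercube n) r &
    forall t, (t <= T)%N -> ~ captured_in_round s r t.
Proof.
move=> n_gt0 s_legal a0 a_step start.
(* Beyond round [T] the invariant is vacuous and the robber stands still. *)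
pose P h x := (size h <= T)%N -> \sum_i weight (a (size h)) (s h i) x < 1.
have [x0 Px0] : exists x, P [::] x.
  have [|x hx] := @exists_lt1 _
    (fun x : {ffun 'I_n -> bool} => \sum_i weight (a 0%N) (s [::] i) x).
    rewrite exchange_big (eq_bigr _ (fun i _ => sum_weight _ _)).
    rewrite sumr_const card_ord card_ffun card_bool card_ord -[ltLHS]mulr_natl natrX.
    by move: start; rewrite expr_div_n !mulrA ltr_pdivrMr ?exprn_gt0 // mul1r.
  by exists x => _.
have step h x : P h x ->
    exists2 y, game_move (@hypercube n) x y & P (rcons h x) y.
  move=> Phx; have [hT|hT] := ltnP (size h) T; last first.
    exists x; first by rewrite /game_move eqxx.
    by move=> /[!size_rcons]; rewrite ltnNge hT.
  have [|j hj] := @exists_lt1 _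
    (fun j : 'I_n => \sum_i weight (a (size h).+1) (s (rcons h x) i) (flip j x)).
    rewrite exchange_big card_ord.
    apply: (@le_lt_trans _ _ (\sum_i n%:R * weight (a (size h)) (s h i) x)).
      by apply: ler_sum => i _; apply: sum_flip_weight (s_legal _ _ _) => //; exact: a_step.
    by rewrite -big_distrr /= gtr_pMr ?ltr0n //; apply: Phx; exact: ltnW.
  exists (flip j x); first by rewrite /game_move hypercube_flip orbT.
  by move=> _; rewrite size_rcons.
have [r r_legal Pr] := robber_of_invariant Px0 step.
have far t i : (t <= T)%N -> (1 < hdist (s (mkseq r t) i) (r t))%N.
  move=> tT; apply: (@weight_lt1 (a t)) => //.
  have := Pr t; rewrite /P size_mkseq => /(_ tT); apply: le_lt_trans.
  by rewrite (bigD1 i) //= lerDl sumr_ge0 // => ? _; exact: weight_ge0.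
exists r => // t tT [i [sr|[t0 sr]]].
  by have := far t i tT; rewrite sr hdistxx.
(* Capture by the cops' move in round [t.+1] needs a cop within distance 1 after round [t]. *)
case: t t0 sr tT => // t _ /= sr tT.
have := hdist_move (r t) (s_legal (mkseq r t) (r t) i).
by rewrite -mkseqS sr hdistxx leqNgt far // ltnW.
Qed.

End Potential.

(** The supremum over robbers is taken for a fixed strategy, so the evading walk may depend on
    [s]. *)
Lemma le_capt (R : realType) (V : finType) (e : rel V) (k : nat) (B : R) :
  (forall s : cop_strategy V k, legal_cops e s ->
     exists2 r, legal_robber e r &
       forall t, captured_in_round s r t -> B <= t%:R) ->
  (B%:E <= capt e R k)%E.
Proof.
move=> H; apply: le_ereal_inf_tmp => _ [s s_legal <-].
have [r r_legal rB] := H s s_legal.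
apply: (@le_trans _ _ (rounds_to_capture R s r)).
  by apply: le_ereal_inf_tmp => _ [t /rB tB <-]; rewrite lee_fin.
by apply: ereal_sup_ubound; exists r.
Qed.

(** * Elementary bounds on the exponential *)

Section Estimates.
Context (R : realType).
Implicit Types d x u : R.

(** From exp(2x) (1 - 2x) <= 1 follows exp(2x) - 1 <= 2x exp(2x), and the range of [x] is exactly (1
    + d) (1 - 2x) >= 1, which gives exp(2x) <= 1 + d. *)
Lemma expR2_sub1_le d x : 0 < d -> 0 <= x <= d / (2 * (1 + d)) ->
  expR (2 * x) - 1 <= 2 * (1 + d) * x.
Proof.
move=> d0 /andP[x0 xd].
have xd' : x * (2 * (1 + d)) <= d by rewrite -ler_pdivlMr //; nra.
have E0 := expR_gt0 (2 * x).
have h : expR (2 * x) * (1 - 2 * x) <= 1.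
  rewrite -[leRHS](expRxMexpNx_1 (2 * x)).
  by rewrite ler_wpM2l ?(ltW E0) //; exact: expR_ge1Dx.
have u0 : 0 < 1 - 2 * x by nra.
have : expR (2 * x) <= 1 + d by rewrite -(ler_pM2r u0); nra.
nra.
Qed.

Lemma expR_le_subr1 u : 0 <= u < 1 -> expR (- (u / (1 - u))) <= 1 - u.
Proof.
move=> /andP[u0 u1]; have v0 : 0 < 1 - u by rewrite subr_gt0.
rewrite expRN invf_ple ?posrE ?expR_gt0 //.
apply: le_trans (expR_ge1Dx _).
suff -> : 1 + u / (1 - u) = (1 - u)^-1 by [].
by field; rewrite gt_eqF.
Qed.

(** On [0, 1], exp(-x) <= 1 / (1 + x) <= 1 - x / 2, so the mean is at most 1 - x / 4. *)
Lemma mean1_expRN_le x : 0 <= x <= 1 -> (1 + expR (- x)) / 2 <= expR (- (x / 4)).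
Proof.
move=> /andP[x0 x1].
have h : expR (- x) * (1 + x) <= 1.
  rewrite -[leRHS](expRxMexpNx_1 x) mulrC.
  by rewrite ler_wpM2r ?expR_ge0 // expR_ge1Dx.
have h2 : expR (- x) <= 1 - x / 2 by rewrite -(@ler_pM2r _ (1 + x)); nra.
apply: le_trans (expR_ge1Dx _); lra.
Qed.

End Estimates.

(** * Choice of constants and comparison of growth rates *)

Theorem theorem3p4 (R : realType) (alpha alpha' : R) (k : nat -> nat)
  (halpha : 0 < alpha) (halpha' : alpha < alpha') (halpha'1 : alpha' < 1)
  (hk : \forall n \near \oo, (cop_number (@hypercube n) <= k n)%N /\
                             (k n)%:R <= expR (n%:R `^ alpha)) :
  \forall n \near \oo,
    (((1 - alpha') / 2 * (n%:R - 1) * ln n%:R)%:E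
       <= capt (@hypercube n) R (k n))%E.
Proof.
(* Small enough that [beta] < 1 - [alpha]. One factor 1 + d of [beta] comes from [c], the other from
   n <= (1 + d) (n - c). *)
pose d := (alpha' - alpha) / 4.
have d0 : 0 < d by rewrite /d; lra.
have d1 : d < 1 by rewrite /d; lra.
pose beta := (1 - alpha') * (1 + d) ^+ 2.
have gamma0 : 0 < 1 - beta - alpha.
  have : (1 + d) ^+ 2 <= 1 + 3 * d by nra.
  rewrite /beta => h; suff : (1 - alpha') * (1 + 3 * d) < 1 - alpha by nra.
  by rewrite /d; nra.
pose e := d / (2 * (1 + d)).
have e0 : 0 < e by rewrite divr_gt0 //; lra.
have e1 : e <= 1 by rewrite ler_pdivrMr; lra.
pose c := 2 * (1 + d).
near=> n.
have kn : (k n)%:R <= expR (n%:R `^ alpha) by near: n; apply: filterS hk => ? [].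
have n8 : 8 <= n%:R :> R by near: n; exact: nbhs_infty_ger.
have nc : c * (1 + d) / d <= n%:R by near: n; exact: nbhs_infty_ger.
(* Equivalently, n^(1 - beta - alpha) exceeds 8 / e. *)
have ngamma : ln (8 / e) / (1 - beta - alpha) < ln n%:R.
  have : expR (ln (8 / e) / (1 - beta - alpha)) < n%:R.
    by near: n; exact: nbhs_infty_gtr.
  by move=> ?; rewrite -ltr_expR lnK // posrE; lra.
have n0 : (0 < n)%N by rewrite -(ltr0n R); lra.
set L := ln n%:R in ngamma *.
have nL : n%:R = expR L by rewrite lnK // posrE ltr0n.
have L0 : 0 <= L by rewrite ln_ge0 //; lra.
have nalpha : n%:R `^ alpha = expR (alpha * L) by rewrite /powR pnatr_eq0 gtn_eqF.
have cn : c < n%:R by rewrite /c; lra.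
have nc' : n%:R <= (1 + d) * (n%:R - c).
  by move: nc; rewrite ler_pdivrMr //; nra.
set B := (1 - alpha') / 2 * (n%:R - 1) * L.
have B0 : 0 <= B by rewrite !mulr_ge0 //; lra.
pose T := Num.truncn B.
have /andP[TB BT] := truncn_itv B0; rewrite -/T in TB BT.
pose q := 1 - c / n%:R.
have c0 : 0 < c by rewrite /c; lra.
have nR0 : 0 < n%:R :> R by rewrite ltr0n.
have cn1 : 0 <= c / n%:R < 1 by rewrite divr_ge0 ?ltr_pdivrMr ?mul1r //= ltW.
have /andP[q0 q1] : 0 <= q <= 1 by rewrite /q; lra.
(* Truncated subtraction freezes [a] at [e] from round [T] on. *)
pose a t := e * q ^+ (T - t).
have a0 t : 0 <= a t by rewrite mulr_ge0 ?exprn_ge0 // ltW.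
have ae t : a t <= e by rewrite ger_pMr // exprn_ile1.
apply: le_capt => s s_legal.
have [t tT||r r_legal r_free] := evasion (T := T) n0 s_legal a0; last first.
(* No capture through round [T] forces t >= T + 1 > B. *)
- exists r => // t rt; apply/ltW/(lt_le_trans BT).
  by rewrite ler_nat ltnNge; apply/negP => /r_free.
(* That is, q^T >= n^(- beta), by 1 - u >= exp(- u / (1 - u)) at u = c / n. *)
- have qT : expR (- (beta * L)) <= q ^+ T.
    apply: (@le_trans _ _ (expR (- (c / n%:R / (1 - c / n%:R))) ^+ T)).
      rewrite -expRM_natl ler_expR mulrN lerN2.
      have -> : c / n%:R / (1 - c / n%:R) = c / (n%:R - c).
        by field; rewrite !gt_eqF // subr_gt0.
      rewrite mulrA ler_pdivrMr ?subr_gt0 //.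
      apply: (@le_trans _ _ (B * c)); first by rewrite ler_pM2r.
      apply: (@le_trans _ _ ((1 - alpha') * (1 + d) * L * n%:R)).
        rewrite /B /c; have : 0 <= (1 - alpha') * (1 + d) * L by rewrite !mulr_ge0 //; lra.
        nra.
      have -> : beta * L * (n%:R - c) =
        (1 - alpha') * (1 + d) * L * ((1 + d) * (n%:R - c)) by rewrite /beta; ring.
      by rewrite ler_wpM2l // !mulr_ge0 //; lra.
    by rewrite lerXn2r ?nnegrE ?expR_ge0 //; exact: expR_le_subr1.
  have na0 : expR (alpha * L) < n%:R * a 0%N / 8.
    rewrite /a subn0 ltr_pdivlMr //.
    apply: (@lt_le_trans _ _ (n%:R * (e * expR (- (beta * L))))); last first.
      by rewrite ler_pM2l // ler_pM2l.
    have -> : n%:R * (e * expR (- (beta * L))) =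
        expR (alpha * L) * (e * expR ((1 - beta - alpha) * L)).
      by rewrite nL mulrCA [RHS]mulrCA -!expRD; congr (_ * expR _); ring.
    rewrite ltr_pM2l ?expR_gt0 // mulrC -ltr_pdivrMr //.
    have e8 : 0 < 8 / e by rewrite divr_gt0.
    by rewrite -[ltLHS]lnK ?posrE // ltr_expR [ltRHS]mulrC -ltr_pdivrMr.
  apply: (@le_lt_trans _ _ (expR (n%:R `^ alpha) *
     (expR (a 0%N) * expR (- (a 0%N / 4)) ^+ n))).
    rewrite ler_pM ?mulr_ge0 ?expR_ge0 ?exprn_ge0 ?divr_ge0 ?addr_ge0 ?expR_ge0 //.
    rewrite ler_wpM2l ?expR_ge0 // lerXn2r ?nnegrE ?expR_ge0 //.
    by apply: mean1_expRN_le; rewrite a0 (le_trans (ae _)).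
  rewrite -expRM_natl -!expRD expR_lt1 nalpha.
  (* Half of n a_0 / 4 outweighs n^alpha by [na0]; the other half covers a_0 since n >= 8. *)
  have : a 0%N * 8 <= a 0%N * n%:R by rewrite ler_wpM2l.
  by nra.
- have -> : a t = a t.+1 * q by rewrite /a -mulrA -exprSr subnSK.
  have -> : n%:R * (a t.+1 - a t.+1 * q) = c * a t.+1.
    by rewrite /q; field; rewrite gt_eqF.
  by apply: expR2_sub1_le => //; rewrite a0 ae.
Unshelve. all: by end_near.
Qed.
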